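(* Let $P \in \mathcal P(\mathbb S^{d-1})$. Then there exists a flag halfspace $F \in \mathcal F$ that satisfies $$P(F) = \inf\{P(G) : G \in \mathcal F\}.$$ For any such $F$ and every $x \in F \cap \mathbb S^{d-1}$ we have $\mathrm{ahD}(x;P) = \min_{y \in \mathbb S^{d-1}} \mathrm{ahD}(y;P)$. In particular, for any $\mu \in \mathbb S^{d-1}$ satisfying $\mathrm{ahD}(\mu;P) = \sup_{x \in \mathbb S^{d-1}} \mathrm{ahD}(x;P)$ we have $\mathrm{ahD}(-\mu;P) = \inf_{x \in \mathbb S^{d-1}} \mathrm{ahD}(x;P)$.
   Context: Let $d \ge 2$ be an integer, $\mathbb S^{d-1} = \{x \in \mathbb R^d : \|x\| = 1\}$, and let $\mathcal P(\mathbb S^{d-1})$ be the set of Borel probability measures on $\mathbb S^{d-1}$. For a Borel set $A \subseteq \mathbb R^d$ and $P \in \mathcal P(\mathbb S^{d-1})$, write $P(A) = P(A \cap \mathbb S^{d-1})$. For $u \in \mathbb S^{d-1}$ let $H_{0,u} = \{y \in \mathbb R^d : \langle y,u\rangle \ge 0\}$. The angular halfspace depth is $$\mathrm{ahD}(x;P) = \inf\{P(H_{0,u}) : u \in \mathbb S^{d-1},\ x \in H_{0,u}\},\qquad x \in \mathbb S^{d-1}.$$ Flag halfspaces: $\mathcal F$ is the system of all sets of the form $F = \{0\} \cup \bigcup_{k=1}^d G_k$, where $G_d \subset \mathbb R^d$ is an open halfspace whose boundary passes through the origin, and for every $k = 1,\dots,d-1$ the set $G_k$ is a (relatively) open halfspace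 inside the $k$-dimensional relative boundary of $G_{k+1}$ (a $k$-dimensional linear subspace) such that the relative boundary of $G_k$ passes through the origin. Elements of $\mathcal F$ are called flag halfspaces. *)

(* Defs.v *)
From HB Require Import structures.
From mathcomp Require Export all_boot all_order all_algebra.
From mathcomp Require Export all_classical all_reals all_analysis.
Export Order.TTheory GRing.Theory Num.Theory.
Export numFieldNormedType.Exports.

Set Implicit Arguments.
Unset Strict Implicit.
Unset Printing Implicit Defensive.

Local Open Scope classical_set_scope.
Local Open Scope ring_scope.

Section euclidean.
Context {R : realType} {d : nat}.
Implicit Types x y : 'rV[R]_d.

Definition dot x y : R := \sum_(i < d) x ord0 i * y ord0 i.

(* The library norm on 'rV[R]_d is the sup norm; it induces the same topology,
   but the unit sphere has to be that of the Euclidean norm. *)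
Definition enorm x : R := Num.sqrt (dot x x).

Definition H0 (u : 'rV[R]_d) : set 'rV[R]_d := [set y | 0 <= dot y u].

End euclidean.

Definition sphere (R : realType) (d : nat) : set 'rV[R]_d :=
  [set x | enorm x = 1].
Arguments sphere R d : clear implicits.

Lemma sphere_delta (R : realType) (d : nat) (i : 'I_d) :
  sphere R d (delta_mx ord0 i).
Proof.
rewrite /sphere /enorm /dot /= (bigD1 i) //= big1 ?addr0.
  by rewrite mxE !eqxx mulr1 sqrtr1.
by move=> j ji; rewrite mxE (negbTE ji) andbF mulr0.
Qed.

(* Measurable types are pointed in the library, hence the dependency on a
   proof that the sphere is nonempty. The topology is the subspace one. *)
Definition sphere_type (R : realType) (d : nat) (hd : (2 <= d)%N) : Type :=
  set_type (sphere R d).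

Section sphere_type.
Context (R : realType) (d : nat) (hd : (2 <= d)%N).

HB.instance Definition _ := Topological.on (sphere_type R hd).
HB.instance Definition _ := isPointed.Build (sphere_type R hd)
  (exist (fun x => x \in sphere R d) _
     (mem_set (sphere_delta R (Ordinal (ltnW hd))))).

Definition borel_sphere := g_sigma_algebraType (@open (sphere_type R hd)).

Definition sphere_val (x : borel_sphere) : 'rV[R]_d := set_val x.

End sphere_type.

Section angular_depth.
Context {R : realType} {d : nat} {hd : (2 <= d)%N}.
Variable P : probability (borel_sphere R hd) R.

(* P(A) := P(A `&` sphere), for A a Borel subset of R^d *)
Definition mass (A : set 'rV[R]_d) : \bar R := P (@sphere_val R d hd @^-1` A).

Definition ahD (x : 'rV[R]_d) : \bar R :=
  ereal_inf [set mass (H0 u) | u in [set u | sphere R d u /\ H0 u x]].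

End angular_depth.

Section flag_halfspaces.
Context {R : realType} {d : nat}.
Implicit Types L G F : set 'rV[R]_d.

(* G is a relatively open (affine) halfspace of the linear subspace L. *)
Definition open_halfspace_in L G : Prop :=
  exists (v : 'rV[R]_d) (c : R),
    [/\ L v, v != 0 & G = L `&` [set y | c < dot y v]].

(* Boundary in the topology of L; this is the relative boundary of G when L is
   the affine hull of G, which is the case for relatively open halfspaces. *)
Definition rel_boundary L G : set 'rV[R]_d :=
  L `&` closure G `&` closure (L `\` G).

(* L k is the k-dimensional linear subspace in which G k is a halfspace. The
   dimension is not prescribed: it drops by one at each step from L d = R^d. *)
Definition flag_halfspace F : Prop :=
  exists L G : nat -> set 'rV[R]_d,
    [/\ L d = setT,
        forall k, (1 <= k < d)%N -> L k = rel_boundary (L k.+1) (G k.+1),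
        forall k, (1 <= k <= d)%N ->
          open_halfspace_in (L k) (G k) /\ rel_boundary (L k) (G k) 0
      & F = [set 0] `|` \bigcup_(k in [set k | (1 <= k <= d)%N]) G k].

End flag_halfspaces.

Definition is_min {R : realType} (A : set (\bar R)) (m : \bar R) : Prop :=
  A m /\ lbound A m.

(* Main.v *)
Require Import Defs.

Set Implicit Arguments.
Unset Strict Implicit.
Unset Printing Implicit Defensive.

Local Open Scope classical_set_scope.
Local Open Scope ring_scope.

(** Fix an orthonormal family v 1, ..., v d and let lex_cone v consist of 0 and
    of the vectors whose first nonzero coordinate, in the order
    v d, v d.-1, ..., v 1, is positive. Flag halfspaces are exactly these
    lexicographic cones (flag_halfspaceP), so a flag halfspace F contains y or
    - y for every y. Write m for the infimum of the masses of flag halfspaces.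

    The infimum is attained by a compactness argument which goes through the
    dimensions one by one. Inside the linear space L that is left, each flag
    halfspace F n of a minimizing sequence contains some open halfspace of L,
    with unit normal u n (flag_space_support). Along a subsequence u n tends to
    some x, and then every y of L with 0 < dot y x lies in almost all F n; the
    points of L with dot y x = 0 form the next, smaller space. The
    limits x form an orthonormal family whose cone G satisfies: every point of
    G belongs to almost all members of one fixed subsequence (flag_limit).
    Fatou's lemma for sets then bounds the mass of G by m.

    Every H0 u contains a flag halfspace whose first normal is u, so no depth is
    below m. Conversely, for a flag halfspace F = lex_cone v tilt the first normal
    slightly, to v d + t v d.-1 + t^2 v d.-2 + ..., with t going to 0. The
    corresponding closed halfspaces converge pointwise, off the origin, to F, and
    eventually contain any given nonzero x of F. Hence the depth of x is at
    most the mass of F (ahD_le_flag), and equals m when F is minimal.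

    Finally, let F be minimal and mu a deepest point. If - mu lies in F, its depth
    is m. Otherwise mu lies in F, so the maximal depth is m and the depth
    is constant. *)

(** * The Euclidean scalar product *)

Lemma sum_continuous (R : realType) (T : topologicalType) (I : Type)
    (r : seq I) (f : I -> T -> R) :
  (forall i, continuous (f i)) -> continuous (fun x => \sum_(i <- r) f i x).
Proof.
move=> fc; elim: r => [|i r IH].
  under eq_fun do rewrite big_nil; move=> x; exact: cvg_cst.
by under eq_fun do rewrite big_cons; move=> x; apply: cvgD; [exact: fc|exact: IH].
Qed.

Section dot_product.
Context {R : realType} {d : nat}.
Implicit Types (x y z u : 'rV[R]_d) (a : R).

Lemma dotC x y : dot x y = dot y x.
Proof. by apply: eq_bigr => i _; rewrite mulrC. Qed.

Lemma dotDl x y z : dot (x + y) z = dot x z + dot y z.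
Proof. by rewrite -big_split /=; apply: eq_bigr => i _; rewrite mxE mulrDl. Qed.

Lemma dotZl a x y : dot (a *: x) y = a * dot x y.
Proof. by rewrite mulr_sumr; apply: eq_bigr => i _; rewrite mxE mulrA. Qed.

Lemma dotDr x y z : dot x (y + z) = dot x y + dot x z.
Proof. by rewrite dotC dotDl !(dotC x). Qed.

Lemma dotZr a x y : dot x (a *: y) = a * dot x y.
Proof. by rewrite dotC dotZl dotC. Qed.

Lemma dotNl x y : dot (- x) y = - dot x y.
Proof. by rewrite -scaleN1r dotZl mulN1r. Qed.

Lemma dot0l x : dot 0 x = 0.
Proof. by rewrite -(scale0r 0) dotZl mul0r. Qed.

Lemma dot0r x : dot x 0 = 0.
Proof. by rewrite dotC dot0l. Qed.

Lemma dot_sumr x (I : Type) (r : seq I) (P : pred I) (F : I -> 'rV[R]_d) :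
  dot x (\sum_(i <- r | P i) F i) = \sum_(i <- r | P i) dot x (F i).
Proof. by apply: (big_morph (dot x)) => [u v|]; rewrite (dotDr, dot0r). Qed.

Lemma dot_ge0 x : 0 <= dot x x.
Proof. by apply: sumr_ge0 => i _; rewrite -expr2 sqr_ge0. Qed.

Lemma dot_eq0 x : dot x x = 0 -> x = 0.
Proof.
move=> /eqP; rewrite psumr_eq0 => [/allP x0|i _]; last by rewrite -expr2 sqr_ge0.
apply/rowP => i; have := x0 i (mem_index_enum _).
by rewrite mulf_eq0 orbb mxE => /eqP.
Qed.

Lemma dot_gt0 x : x != 0 -> 0 < dot x x.
Proof.
by rewrite lt_def dot_ge0 andbT; apply: contra_neq => /dot_eq0.
Qed.

Lemma sphereP x : sphere R d x <-> dot x x = 1.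
Proof.
rewrite /sphere /enorm /=; split=> [x1|->]; last exact: sqrtr1.
by rewrite -(sqr_sqrtr (dot_ge0 x)) x1 expr1n.
Qed.

Lemma unit_neq0 x : dot x x = 1 -> x != 0.
Proof. by apply: contra_eq_neq => ->; rewrite dot0l eq_sym oner_neq0. Qed.

Lemma normalize x : x != 0 ->
  exists2 a, 0 < a & dot (a *: x) (a *: x) = 1.
Proof.
move=> /dot_gt0 x0; exists (Num.sqrt (dot x x))^-1.
  by rewrite invr_gt0 sqrtr_gt0.
rewrite dotZl dotZr mulrA -invfM -expr2 sqr_sqrtr ?dot_ge0// mulVf//.
exact: lt0r_neq0.
Qed.

Lemma dot_continuous u : continuous (fun x => dot x u).
Proof.
apply: sum_continuous => i x; apply: continuousM; first exact: coord_continuous.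
by move=> ?; exact: cst_continuous.
Qed.

Lemma closed_dot_ge a u : closed [set y | a <= dot y u].
Proof.
apply: (@closed_comp _ _ (dot^~ u) [set t | a <= t]).
  by move=> x _; exact: dot_continuous.
exact: closed_ge.
Qed.

Lemma closed_dot_le a u : closed [set y | dot y u <= a].
Proof.
apply: (@closed_comp _ _ (dot^~ u) [set t | t <= a]).
  by move=> x _; exact: dot_continuous.
exact: closed_le.
Qed.

Lemma closed_dot_eq a u : closed [set y | dot y u = a].
Proof.
apply: (@closed_comp _ _ (dot^~ u) [set t | t = a]).
  by move=> x _; exact: dot_continuous.
exact: closed_eq.
Qed.

Lemma unit_sphere_compact : compact [set x : 'rV[R]_d | dot x x = 1].
Proof.
apply: bounded_closed_compact.
  exists 1; split; first exact: num_real.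
  move=> M M1 x /= x1; apply: (le_trans _ (ltW M1)).
  rewrite /Num.norm/= mx_normrE; apply: bigmax_le => //= -[i j] _ /=.
  rewrite ord1 -(@ler_pXn2r _ 2)// ?nnegrE// expr1n real_normK ?num_real//.
  rewrite -x1 /dot (bigD1 j)//= -expr2 lerDl sumr_ge0// => k _.
  by rewrite -expr2 sqr_ge0.
apply: (@closed_comp _ _ (fun x => dot x x) [set t | t = 1]).
  move=> x _; apply: sum_continuous => i y.
  by apply: continuousM; exact: coord_continuous.
exact: closed_eq.
Qed.

End dot_product.

(** * Orthonormal families and lexicographic cones *)

Section frames.
Context {R : realType} {d : nat}.
Implicit Types (v w : nat -> 'rV[R]_d) (x y u : 'rV[R]_d) (k : nat).

(** A family of normals is numbered 1, ..., d as the spaces of a flag, from the top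
    down: v d is the normal of the open halfspace of the whole space and, for
    orthonormal v, flag_space v k is the space of dimension k that is left after
    cutting by v d, ..., v k.+1. *)
Definition flag_space v k : set 'rV[R]_d :=
  [set y | forall j, (k < j <= d)%N -> dot y (v j) = 0].

Definition orthonormal_above k v : Prop :=
  forall i j, (k < i <= d)%N -> (k < j <= d)%N -> dot (v i) (v j) = (i == j)%:R.

Definition lex_cone v : set 'rV[R]_d :=
  [set 0] `|` \bigcup_(k in [set k | (1 <= k <= d)%N])
     (flag_space v k `&` [set y | 0 < dot y (v k)]).

Lemma flag_spaceD v k x y :
  flag_space v k x -> flag_space v k y -> flag_space v k (x + y).
Proof. by move=> xk yk j jk; rewrite dotDl xk// yk// addr0. Qed.

Lemma flag_spaceZ v k a x : flag_space v k x -> flag_space v k (a *: x).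
Proof. by move=> xk j jk; rewrite dotZl xk// mulr0. Qed.

Lemma flag_spaceS v k : (k < d)%N ->
  flag_space v k = flag_space v k.+1 `&` [set y | dot y (v k.+1) = 0].
Proof.
move=> kd; apply/seteqP; split => y.
  move=> yk; split=> /=; last by apply: yk; rewrite ltnSn.
  by move=> j /andP[kj jd]; apply: yk; rewrite jd (ltnW kj).
move=> [yk /= y0] j /andP[]; rewrite leq_eqVlt => /orP[/eqP <- //|kj jd].
by apply: yk; rewrite kj.
Qed.

Lemma flag_space_top v : flag_space v d = setT.
Proof.
by apply/seteqP; split=> // y _ j /andP[dj jd]; have := leq_trans dj jd; rewrite ltnn.
Qed.

Lemma closed_flag_space v k : closed (flag_space v k).
Proof.
have -> : flag_space v k =
    \bigcap_(j in [set j | (k < j <= d)%N]) [set y | dot y (v j) = 0] by [].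
by apply: closed_bigI => j _; exact: closed_dot_eq.
Qed.

Lemma orthonormal_above_mem v k j :
  orthonormal_above j v -> (j < k <= d)%N -> flag_space v k (v k).
Proof.
move=> on /andP[jk kd] i /andP[ki id]; rewrite on ?(ltn_eqF ki)//.
  by rewrite jk.
by rewrite id (ltn_trans jk).
Qed.

(** Fewer than d linear conditions have a common nonzero solution: put their
    vectors in a square matrix, whose missing rows are 0 and make it singular. *)
Lemma flag_space_unit v k : (0 < k <= d)%N ->
  exists2 x, flag_space v k x & dot x x = 1.
Proof.
move=> /andP[k0 kd]; have d0 : (0 < d)%N := leq_trans k0 kd.
pose A : 'M[R]_d := \matrix_(i < d) (if (k <= i)%N then v i.+1 else 0).
have /det0P[x x0 xA] : \det A^T == 0.
  rewrite det_tr; apply/det0P; exists (delta_mx ord0 (Ordinal d0)).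
    by apply/eqP => /rowP/(_ (Ordinal d0)); rewrite !mxE !eqxx => /eqP; rewrite oner_eq0.
  by rewrite -rowE rowK leqNgt k0.
have [a a0 a1] := normalize x0; exists (a *: x) => //; apply: flag_spaceZ.
move=> [//|j] /andP[kj jd].
have /rowP/(_ (Ordinal jd)) := xA; rewrite [LHS]mxE [RHS]mxE => /esym xA0.
by rewrite xA0; apply: eq_bigr => i _; rewrite !mxE -ltnS kj.
Qed.

(** A left inverse of a square matrix is a right inverse, so a family of d
    orthonormal vectors detects every vector. *)
Lemma frame_eq0 v y : orthonormal_above 0 v -> flag_space v 0 y -> y = 0.
Proof.
move=> on y0; pose A : 'M[R]_d := \matrix_(i < d) v i.+1.
have AA : A *m A^T = 1%:M.
  apply/matrixP => i j; rewrite mxE [RHS]mxE.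
  have := on i.+1 j.+1; rewrite !ltn_ord => /(_ isT isT); rewrite eqSS => <-.
  by rewrite /dot; apply: eq_bigr => k _; rewrite !mxE.
have yA : y *m A^T = 0.
  apply/rowP => j; rewrite [LHS]mxE [RHS]mxE -[RHS](y0 j.+1) ?ltn_ord//.
  by apply: eq_bigr => k _; rewrite !mxE.
by rewrite -(mulmx1 y) -(mulmx1C AA) mulmxA yA mul0mx.
Qed.

Lemma frame_leading v y : orthonormal_above 0 v -> y != 0 ->
  exists k, [/\ (1 <= k <= d)%N, flag_space v k y & dot y (v k) != 0].
Proof.
move=> on y0.
pose Q := [pred k | [&& (1 <= k)%N, (k <= d)%N & dot y (v k) != 0]].
have Qex : exists k, Q k.
  apply: contrapT => noQ; move/negP: y0; apply; apply/eqP.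
  apply: (frame_eq0 on) => j /andP[j0 jd]; apply/eqP; apply: contraT => yj.
  by case: noQ; exists j; rewrite /= j0 jd yj.
have Qle k : Q k -> (k <= d)%N by case/and3P.
case: (ex_maxnP Qex Qle) => k /and3P[k0 kd yk] kmax.
exists k; split; rewrite ?k0 ?kd//.
move=> j /andP[kj jd]; apply/eqP; apply: contraT => yj.
have : (j <= k)%N by apply: kmax; rewrite /= yj jd (leq_ltn_trans _ kj).
by rewrite leqNgt kj.
Qed.

Lemma lex_coneN v y : orthonormal_above 0 v -> y != 0 ->
  ~ lex_cone v y -> lex_cone v (- y).
Proof.
move=> on y0 yv; have [k [kd yk ky]] := frame_leading on y0.
right; exists k => //=; split.
  by rewrite -scaleN1r; exact: flag_spaceZ.
rewrite dotNl oppr_gt0 lt_neqAle ky leNgt; apply/negP => yk0.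
by apply: yv; right; exists k.
Qed.

(** A point y of the hyperplane is in the closure of the halfspace because
    y + x / n tends to y; this is why L has to be stable under translations
    along x. *)
Lemma rel_boundary_halfspace (L : set 'rV[R]_d) x c : x != 0 ->
  (forall y a, L y -> L (y + a *: x)) ->
  rel_boundary L (L `&` [set y | c < dot y x]) =
  L `&` [set y | dot y x = c].
Proof.
move=> x0 Lx; apply/seteqP; split => y.
  move=> [[Ly cy] yc]; split=> //=; apply/eqP; rewrite eq_le; apply/andP; split.
    have : [set z | dot z x <= c] y; last by [].
    apply: closed_dot_le; apply: closureS yc => z [Lz /not_andP[//|/negP]].
    by rewrite -leNgt.
  have : [set z | c <= dot z x] y; last by [].
  by apply: closed_dot_ge; apply: closureS cy => z [_ /ltW].
move=> [Ly /= yc]; split; first split=> //.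
  have ycvg : y + n.+1%:R^-1 *: x @[n --> \oo] --> y.
    rewrite -[X in _ --> X]addr0 -(scale0r x).
    apply: cvgD; first exact: cvg_cst.
    by apply: cvgZr_tmp; exact: cvg_harmonic.
  move=> B /ycvg [N _ /(_ N (leqnn _)) /= BN].
  exists (y + N.+1%:R^-1 *: x); split=> //; split; first exact: Lx.
  by rewrite /= dotDl dotZl yc ltrDl mulr_gt0// ?dot_gt0// invr_gt0 ltr0n.
by apply: subset_closure; split=> // -[_ /=]; rewrite yc ltxx.
Qed.

Lemma rel_boundary_flag_space v k : orthonormal_above 0 v ->
  (0 < k <= d)%N ->
  rel_boundary (flag_space v k) (flag_space v k `&` [set y | 0 < dot y (v k)])
    = flag_space v k.-1.
Proof.
move=> on kd; rewrite rel_boundary_halfspace.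
- by case: k kd => [//|k] kd; rewrite -flag_spaceS.
- by apply: unit_neq0; rewrite on ?eqxx.
move=> y a yk; apply: flag_spaceD => //; apply: flag_spaceZ.
exact: orthonormal_above_mem on kd.
Qed.

(** The halfspaces of a flag are a priori affine, with an offset c; as 0 is on
    the relative boundary, c = 0. Each space of the flag is then cut out of the
    previous one by the orthogonality to a normal, and a normal lies in its own
    space, so it is orthogonal to all earlier normals. *)
Lemma flag_halfspaceP (F : set 'rV[R]_d) : flag_halfspace F <->
  exists2 v, orthonormal_above 0 v & F = lex_cone v.
Proof.
split; last first.
  move=> [v on ->]; exists (flag_space v).
  exists (fun k => flag_space v k `&` [set y | 0 < dot y (v k)]).
  split=> //.
  - exact: flag_space_top.
  - move=> k /andP[k0 kd]; rewrite rel_boundary_flag_space//.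
  - move=> k kd; split.
      exists (v k), 0; split=> //; first exact: orthonormal_above_mem on kd.
      by apply: unit_neq0; rewrite on ?eqxx.
    rewrite rel_boundary_flag_space// => j _; exact: dot0l.
move=> [L [G [Ld Lk Gk ->]]].
(* The facts on the normal of G k use that L k is linear, which is only known
   once L k has been identified, going down from L d. *)
have /choice[v vP] : forall k, exists x, (1 <= k <= d)%N ->
    (forall y z a, L k y -> L k z -> L k (y + a *: z)) ->
    [/\ L k x, dot x x = 1, G k = L k `&` [set y | 0 < dot y x] &
      rel_boundary (L k) (G k) = L k `&` [set y | dot y x = 0]].
  move=> k; have [kd|] := boolP (1 <= k <= d)%N; last by exists 0.
  have [[x [c [Lx x0 GE]]] b0] := Gk k kd.
  have [a a0 ax] := normalize x0; exists (a *: x) => _ Lk_lin.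
  have L0 : L k 0 by case: b0 => -[].
  have bE : rel_boundary (L k) (G k) = L k `&` [set y | dot y x = c].
    by rewrite GE rel_boundary_halfspace// => y b Ly; exact: Lk_lin.
  have c0 : c = 0 by move: b0; rewrite bE => -[_ /=]; rewrite dot0l.
  split=> //.
  - by rewrite -[a *: x]add0r; exact: Lk_lin.
  - rewrite GE c0; congr (_ `&` _); apply/seteqP; split => y /=;
      by rewrite dotZr pmulr_rgt0.
  - rewrite bE c0; congr (_ `&` _); apply/seteqP; split => y /=; rewrite dotZr.
      by move->; rewrite mulr0.
    by move/eqP; rewrite mulf_eq0 gt_eqF//= => /eqP.
(* Descending induction on the dimension, written as d - m. *)
have LE m : (m < d)%N -> L (d - m)%N = flag_space v (d - m)%N.
  elim: m => [|m IH] md; first by rewrite subn0 Ld flag_space_top.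
  have {}IH := IH (ltnW md); pose k := (d - m.+1)%N.
  have k0 : (0 < k)%N by rewrite subn_gt0.
  have kd : (k < d)%N by rewrite ltn_subrL (leq_ltn_trans _ md).
  have kE : (d - m)%N = k.+1 by rewrite /k subnSK// ltnW.
  have k1 : (1 <= k.+1 <= d)%N by [].
  rewrite -/k Lk ?k0// flag_spaceS//; rewrite kE in IH.
  have [|_ _ _ ->] := vP _ k1; last by rewrite IH.
  by rewrite IH => y z a yk zk; apply: flag_spaceD => //; exact: flag_spaceZ.
have {}LE k : (1 <= k <= d)%N -> L k = flag_space v k.
  move=> /andP[k0 kd]; rewrite -(subKn kd) LE// ltn_subrL k0.
  exact: leq_trans kd.
have {}vP k : (1 <= k <= d)%N -> [/\ flag_space v k (v k), dot (v k) (v k) = 1 &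
    G k = flag_space v k `&` [set y | 0 < dot y (v k)]].
  move=> kd; have [|] := vP k kd; rewrite LE// => y z a yk zk.
  by apply: flag_spaceD => //; exact: flag_spaceZ.
exists v.
  move=> i j id jd; have [ij|ji|->] := ltngtP i j; last by case: (vP j jd).
    by have [vi _ _] := vP i id; rewrite vi// ij; case/andP: jd.
  by rewrite dotC; have [vj _ _] := vP j jd; rewrite vj// ji; case/andP: id.
congr (_ `|` _); apply: eq_bigcupr => k /= kd.
by have [_ _] := vP k kd.
Qed.

(** * Sequential compactness of the set of flag halfspaces *)

(** A nonzero subspace L meets a lexicographic cone in a set that contains an open
    halfspace of L. If v j is the first vector, in the order v d, ..., v 1, that is
    not orthogonal to L, then on L the earlier coordinates vanish and the coordinate
    along v j is the scalar product with the orthogonal projection u of v j to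
    L. *)
Lemma flag_space_support v w k :
  orthonormal_above 0 v -> orthonormal_above k w -> (0 < k <= d)%N ->
  exists u, [/\ flag_space w k u, dot u u = 1 &
    forall y, flag_space w k y -> 0 < dot y u -> lex_cone v y].
Proof.
move=> onv onw kd.
pose Q := [pred j | (1 <= j <= d)%N &&
  `[< exists2 y, flag_space w k y & dot y (v j) != 0 >]].
have Qex : exists j, Q j.
  have [x xk /unit_neq0 x0] := flag_space_unit w kd.
  have [j [jd _ xj]] := frame_leading onv x0.
  by exists j; rewrite /= jd; apply/asboolP; exists x.
have Qle j : Q j -> (j <= d)%N by move=> /andP[/andP[]].
case: (ex_maxnP Qex Qle) => j /andP[jd /asboolP[z zk zj]] jmax.
(* The orthogonal projection of v j to flag_space w k. *)
pose p := v j + \sum_(i < d.+1 | (k < i)%N) (- dot (v j) (w i)) *: w i.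
have dot_p y : flag_space w k y -> dot y p = dot y (v j).
  move=> yk; rewrite dotDr dot_sumr big1 ?addr0// => i ki.
  by rewrite dotZr yk ?mulr0// ki leq_ord.
have pk : flag_space w k p.
  move=> l kld; have /andP[kl ld] := kld.
  rewrite dotC dotDr dot_sumr (bigD1 (Ordinal (ltnSE ld : l < d.+1)%N))//=.
  rewrite dotZr onw// eqxx mulr1 dotC big1 ?addr0 ?subrr// => i /andP[ki il].
  rewrite dotZr onw ?ki ?leq_ord// (_ : (l == i) = false) ?mulr0//.
  by apply: contra_neqF il => /eqP li; exact: val_inj.
have p0 : p != 0.
  by apply: contra_neq zj => p0; rewrite -dot_p// p0 dot0r.
have [a a0 a1] := normalize p0; exists (a *: p).
split=> //; first exact: flag_spaceZ.
move=> y yk; rewrite dotZr pmulr_rgt0// dot_p// => yj.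
right; exists j => //=; split=> // i /andP[ji id]; apply: contrapT => /eqP yi.
have : (i <= j)%N; last by rewrite leqNgt ji.
apply: jmax; rewrite /= id (leq_ltn_trans _ ji)//=.
by apply/asboolP; exists y.
Qed.

(** The reindexing f need not be increasing: n <= f n is enough to carry
    properties that hold for all large indices over to the subsequence. *)
Lemma unit_sequence_cvg (u : nat -> 'rV[R]_d) :
  (forall n, dot (u n) (u n) = 1) ->
  exists f x, [/\ forall n, (n <= f n)%N, dot x x = 1 &
    u (f n) @[n --> \oo] --> x].
Proof.
move=> u1; have [|x [/= x1 xcl]] := @unit_sphere_compact R d (u @ \oo) _.
  by exists 0%N => // n _; exact: u1.
have /choice[f fP] : forall n, exists m, (n <= m)%N /\ ball x n.+1%:R^-1 (u m).
  move=> n; have [||y [[m /= nm <-] xm]] :=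
      xcl (u @` [set m | (n <= m)%N]) (ball x n.+1%:R^-1).
  - by exists n => // m /= nm; exists m.
  - exact: nbhsx_ballx.
  by exists m.
exists f, x; split=> //; first by move=> n; case: (fP n).
apply/cvg_ballP => e e0.
have := near_infty_natSinv_lt (PosNum e0); apply: filterS => n /= ne.
by apply: le_ball (ltW ne) _ _; case: (fP n).
Qed.

Definition set_vector w k x : nat -> 'rV[R]_d :=
  fun j => if j == k then x else w j.

Lemma set_vector_gt w k x j : (k < j)%N -> set_vector w k x j = w j.
Proof. by rewrite /set_vector; case: ltngtP. Qed.

Lemma flag_space_set_vector w k x j : (k <= j)%N ->
  flag_space (set_vector w k x) j = flag_space w j.
Proof.
by move=> kj; apply/seteqP; split => y yj i /[dup] id /andP[ji _];
  have := yj _ id; rewrite set_vector_gt// (leq_ltn_trans kj).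
Qed.

Lemma orthonormal_set_vector w k x :
  orthonormal_above k.+1 w -> flag_space w k.+1 x -> dot x x = 1 ->
  orthonormal_above k (set_vector w k.+1 x).
Proof.
move=> on xk x1 i j /andP[ki id] /andP[kj jd]; rewrite /set_vector.
case: (eqVneq i k.+1) => [ik|ik]; case: (eqVneq j k.+1) => [jk|jk].
- by rewrite ik jk eqxx.
- by rewrite xk ?ik 1?[_ == j]eq_sym ?(negbTE jk)// ltn_neqAle eq_sym jk kj.
- by rewrite dotC xk ?jk ?(negbTE ik)// ltn_neqAle eq_sym ik ki.
- by rewrite on// ltn_neqAle eq_sym ?ik ?jk ?ki ?kj.
Qed.

Lemma orthonormal_extend w k : (k <= d)%N -> orthonormal_above k w ->
  exists2 v, orthonormal_above 0 v & forall j, (k < j)%N -> v j = w j.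
Proof.
elim: k w => [|k IH] w kd on; first by exists w.
have [x xk x1] := flag_space_unit w (kd : (0 < k.+1 <= d)%N).
have [v onv vw] := IH _ (ltnW kd) (orthonormal_set_vector on xk x1).
by exists v => // j kj; rewrite vw 1?ltnW// set_vector_gt.
Qed.

Lemma orthonormal_top w : dot (w d) (w d) = 1 -> orthonormal_above d.-1 w.
Proof.
move=> w1 i j /andP[di id] /andP[dj jd].
have -> : i = d by apply/eqP; rewrite eqn_leq id (leq_trans (leqSpred d)).
have -> : j = d by apply/eqP; rewrite eqn_leq jd (leq_trans (leqSpred d)).
by rewrite w1 eqxx.
Qed.

Lemma lex_cone_sub_H0 v : (0 < d)%N -> lex_cone v `<=` H0 (v d).
Proof.
move=> d0 y [->|[k /= /andP[k0]]]; rewrite /H0/= ?dot0l//.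
rewrite leq_eqVlt => /orP[/eqP-> [_ /ltW]//|kd [yk _]].
by rewrite yk ?lexx// kd leqnn.
Qed.

Lemma flag_halfspace_sub_H0 u : (0 < d)%N -> dot u u = 1 ->
  exists2 F, flag_halfspace F & F `<=` H0 u.
Proof.
move=> d0 u1.
have [v on vd] := orthonormal_extend (leq_pred d)
  (@orthonormal_top (fun=> u) u1).
exists (lex_cone v); first by apply/flag_halfspaceP; exists v.
by rewrite -(vd d) ?prednK//; exact: lex_cone_sub_H0.
Qed.

(** Downward construction of a limit family: w is already known above k, along
    the subsequence f, and w k is obtained as a limit of normals of halfspaces of
    flag_space w k contained in the cones. Refining the subsequence keeps what
    is known above k, so that d successive extractions suffice. *)
Lemma flag_limit_rec (v : nat -> nat -> 'rV[R]_d) k w (f : nat -> nat) :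
  (forall n, orthonormal_above 0 (v n)) -> (k <= d)%N ->
  orthonormal_above k w -> (forall n, (n <= f n)%N) ->
  (forall j, (k < j <= d)%N -> forall y, flag_space w j y ->
    0 < dot y (w j) -> \forall n \near \oo, lex_cone (v (f n)) y) ->
  exists g w', [/\ forall n, (n <= g n)%N, orthonormal_above 0 w' &
    forall y, lex_cone w' y -> \forall n \near \oo, lex_cone (v (g n)) y].
Proof.
move=> onv; elim: k w f => [|k IH] w f kd onw nf wlim.
  exists f, w; split=> // y [->|[j jd [yj y0]]]; last exact: wlim yj y0.
  by near=> n; left.
have /choice[u uP] : forall n, exists u, [/\ flag_space w k.+1 u, dot u u = 1 &
    forall y, flag_space w k.+1 y -> 0 < dot y u -> lex_cone (v (f n)) y].
  by move=> n; exact: flag_space_support.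
have [|g [x [ng x1 ugx]]] := @unit_sequence_cvg u.
  by move=> n; case: (uP n).
have xk : flag_space w k.+1 x.
  apply: (closed_cvg (flag_space w k.+1) _ _ _ ugx).
    exact: closed_flag_space.
  by near=> n; case: (uP (g n)).
have on' := orthonormal_set_vector onw xk x1.
apply: (IH (set_vector w k.+1 x) (f \o g) (ltnW kd) on') => [n|j /andP[kj jd] y].
  exact: leq_trans (nf _).
rewrite flag_space_set_vector// => yj.
move: kj; rewrite leq_eqVlt => /orP[/eqP kj|kj].
  rewrite /set_vector kj eqxx => yx.
  have : \forall n \near \oo, 0 < dot y (u (g n)).
    have cv : dot y (u (g n)) @[n --> \oo] --> dot y x.
      under eq_fun do rewrite dotC; rewrite dotC.
      exact: (continuous_cvg _ (@dot_continuous R d y x) ugx).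
    exact: cvgr_gt cv _ yx.
  apply: filterS => n; have [_ _] := uP (g n); apply; by rewrite kj.
rewrite set_vector_gt// => y0.
have [N _ HN] := wlim j (introT andP (conj kj jd)) y yj y0.
by exists N => // n /= Nn; apply: HN => /=; exact: leq_trans (ng n).
Unshelve. all: by end_near.
Qed.

Lemma flag_limit (F : nat -> set 'rV[R]_d) : (forall n, flag_halfspace (F n)) ->
  exists f G, [/\ forall n, (n <= f n)%N, flag_halfspace G &
    forall y, G y -> \forall n \near \oo, F (f n) y].
Proof.
move=> Fflag.
have /choice[v vP] : forall n, exists v, orthonormal_above 0 v /\ F n = lex_cone v.
  by move=> n; have /flag_halfspaceP[v ? ?] := Fflag n; exists v.
have [||||f [w [nf onw wlim]]] := @flag_limit_rec v d (fun=> 0) id _ (leqnn d).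
- by move=> n; case: (vP n).
- by move=> i j /andP[di id]; have := leq_trans di id; rewrite ltnn.
- by [].
- by move=> j /andP[dj jd]; have := leq_trans dj jd; rewrite ltnn.
exists f, (lex_cone w); split=> //; first by apply/flag_halfspaceP; exists w.
move=> y /wlim; apply: filterS => n.
by have [_ ->] := vP (f n).
Qed.

(** * Approximation of a flag halfspace by closed halfspaces *)

(** The sum of the t ^+ (k - j) *: v j for 1 <= j <= k, in Horner form. *)
Fixpoint tilt (t : R) v k : 'rV[R]_d :=
  if k is j.+1 then v k + t *: tilt t v j else 0.

Lemma dot_tilt_cvg v y k : (0 < k)%N ->
  dot y (tilt n.+1%:R^-1 v k) @[n --> \oo] --> dot y (v k).
Proof.
case: k => // k _; elim: k => [|k IH].
  under eq_fun do rewrite /= scaler0 addr0; exact: cvg_cst.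
have -> : (fun n => dot y (tilt n.+1%:R^-1 v k.+2)) =
    (fun n => dot y (v k.+2) + n.+1%:R^-1 * dot y (tilt n.+1%:R^-1 v k.+1)).
  by apply/funext => n; rewrite [tilt _ _ k.+2]/= dotDr dotZr.
rewrite -[X in _ --> X]addr0 -(mul0r (dot y (v k.+1))).
apply: cvgD; first exact: cvg_cst.
by apply: cvgM => //; exact: cvg_harmonic.
Qed.

Lemma dot_tilt t v y k m : (k <= m <= d)%N -> flag_space v k y ->
  dot y (tilt t v m) = t ^+ (m - k) * dot y (tilt t v k).
Proof.
move=> /andP[+ +] yk; elim: m => [|m IH].
  by rewrite leqn0 => /eqP->; rewrite expr0 mul1r.
rewrite leq_eqVlt => /orP[/eqP->|km] md; first by rewrite subnn expr0 mul1r.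
rewrite /= dotDr dotZr yk ?km ?add0r// IH// 1?ltnW// mulrA -exprS subSn//.
Qed.

(** If v k gives the first nonzero coordinate of y, the scalar product of y with
    the tilted normal is t ^+ (d - k) times a quantity that tends to dot y (v k),
    so for small t it has the sign of that coordinate. *)
Lemma lex_cone_tilt v y : lex_cone v y -> y != 0 ->
  \forall n \near \oo, 0 < dot y (tilt n.+1%:R^-1 v d).
Proof.
move=> [->|[k /= kd [yk y0]] _]; first by rewrite eqxx.
have /andP[k0 k1] := kd.
have : \forall n \near \oo, 0 < dot y (tilt n.+1%:R^-1 v k).
  exact: cvgr_gt (@dot_tilt_cvg v y k k0) _ y0.
apply: filterS => n yn; rewrite (dot_tilt _ (k := k))// ?k1 ?leqnn//.
by rewrite mulr_gt0// exprn_gt0// invr_gt0 ltr0n.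
Qed.

End frames.

(** * Fatou's lemma for sets *)

Section liminf_sets.
Context {disp : measure_display} {T : measurableType disp} {R : realType}.
Implicit Types (A : set T) (F : nat -> set T).

(** A is contained in the increasing union of the intersections of the F k for
    k >= n, and each of these intersections has measure at most c for n large. *)
Lemma measure_liminf_le (mu : {measure set T -> \bar R}) A F (c : \bar R) :
  measurable A -> (forall n, measurable (F n)) ->
  (forall x, A x -> \forall n \near \oo, F n x) ->
  (\forall n \near \oo, (mu (F n) <= c)%E) -> (mu A <= c)%E.
Proof.
move=> mA mF AF [N _ Fc]; pose E n := \bigcap_(k in [set k | (n <= k)%N]) F k.
have mE n : measurable (E n) by apply: bigcap_measurableType.
have mUE : measurable (\bigcup_n E n) by exact: bigcupT_measurable.
apply: (@le_trans _ _ (mu (\bigcup_n E n))).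
  apply: le_measure; [by rewrite inE|by rewrite inE|move=> x /AF[M _ FM]].
  by exists M => // k /= /FM.
have ndE : {homo E : n m / (n <= m)%N >-> (n <= m)%O}.
  by move=> n m nm; apply/subsetPset => x Ex k /= mk; apply: Ex; exact: leq_trans mk.
have cvgE := @nondecreasing_cvg_mu _ _ _ mu E mE mUE ndE.
apply: (cvge_to_le cvgE); exists N => // n /= Nn.
apply: le_trans (Fc n Nn); apply: le_measure; rewrite ?inE// => x; apply.
exact: leqnn.
Qed.

(** Fatou for the complements; exchanging them with the sets uses that the total
    mass is finite. *)
Lemma probability_limsup_ge (P : probability T R) A F (c : \bar R) :
  measurable A -> (forall n, measurable (F n)) ->
  (forall x, ~ A x -> \forall n \near \oo, ~ F n x) ->
  (\forall n \near \oo, (c <= P (F n))%E) -> (c <= P A)%E.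
Proof.
move=> mA mF AF cF.
have : (P (~` A) <= 1 - c)%E.
  apply: (@measure_liminf_le P _ (fun n => ~` F n)) => //.
  - exact: measurableC.
  - by move=> n; exact: measurableC.
  apply: filterS cF => n cF; rewrite [leLHS]probability_setC//.
  exact: leeB.
rewrite [leLHS]probability_setC//.
have /fineK <- := fin_num_measure P A mA.
case: c {cF} => [c| |] //=; last by rewrite leNye.
by rewrite -!EFinB !lee_fin lerD2l lerN2.
Qed.

End liminf_sets.

(** * Halfspace masses and the angular halfspace depth *)

Section mass.
Context {R : realType} {d : nat} {hd : (2 <= d)%N}.
Variable P : probability (borel_sphere R hd) R.
Implicit Types (A : set 'rV[R]_d) (x y u : 'rV[R]_d).

Definition trace_measurable A :=
  measurable (@sphere_val R d hd @^-1` A : set (borel_sphere R hd)).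

Lemma sphere_val_unit (s : borel_sphere R hd) :
  dot (sphere_val s) (sphere_val s) = 1.
Proof. exact/sphereP/set_mem/(valP s). Qed.

Lemma closed_trace_measurable A : closed A -> trace_measurable A.
Proof.
move=> cA.
suff : measurable (@sphere_val R d hd @^-1` (~` A) : set (borel_sphere R hd)).
  by move=> /measurableC; rewrite preimage_setC setCK.
by apply: sub_gen_smallest; exists (~` A) => //; rewrite openC.
Qed.

(** Each piece of a lexicographic cone is the trace of an open halfspace on a
    closed subspace. *)
Lemma flag_halfspace_measurable F : flag_halfspace F -> trace_measurable F.
Proof.
move=> /flag_halfspaceP[v _ ->]; rewrite /trace_measurable preimage_setU.
apply: measurableU.
  apply: closed_trace_measurable.
  exact/accessible_closed_set1/hausdorff_accessible/norm_hausdorff.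
rewrite preimage_bigcup; apply: bigcup_measurable => k _.
rewrite preimage_setI; apply: measurableI.
  by apply: closed_trace_measurable; exact: closed_flag_space.
rewrite (_ : [set y | _] = ~` [set y | dot y (v k) <= 0]); last first.
  by apply/seteqP; split => y /=; rewrite ltNge => /negP.
rewrite preimage_setC; apply: measurableC.
exact: (closed_trace_measurable (@closed_dot_le _ _ 0 (v k))).
Qed.

Lemma H0_measurable u : trace_measurable (H0 u).
Proof. by apply: closed_trace_measurable; exact: closed_dot_ge. Qed.

Lemma le_mass A B : trace_measurable A -> trace_measurable B -> A `<=` B ->
  (mass P A <= mass P B)%E.
Proof. by move=> mA mB AB; apply: le_measure; rewrite ?inE// => s; exact: AB. Qed.

Local Notation flags := [set F : set 'rV[R]_d | flag_halfspace F].
Local Notation flag_inf := (ereal_inf [set mass P F | F in flags]).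

Lemma flag_inf_fin_num : flag_inf \is a fin_num.
Proof.
have [F Fflag _] := flag_halfspace_sub_H0 (ltnW hd)
  ((sphereP _).1 (@sphere_delta R d (Ordinal (ltnW hd)))).
rewrite ge0_fin_numE.
  apply: (@le_lt_trans _ _ (mass P F)); last first.
    by rewrite -ge0_fin_numE//; apply: fin_num_measure; exact: flag_halfspace_measurable.
  by apply: ereal_inf_lbound; exists F.
by apply: le_ereal_inf_tmp => _ [G _ <-].
Qed.

(** A minimizing sequence has a subsequence F (f n) with a limit flag halfspace G,
    each point of which is in almost all F (f n); Fatou gives the bound. *)
Lemma flag_inf_attained : exists2 F, flags F & mass P F = flag_inf.
Proof.
have /choice[F FP] : forall n, exists F, flag_halfspace F /\
    (mass P F < flag_inf + n.+1%:R^-1%:E)%E.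
  move=> n; have n0 : 0 < n.+1%:R^-1 :> R by rewrite invr_gt0 ltr0n.
  by have [_ [F Fflag <-] ?] := lb_ereal_inf_adherent n0 flag_inf_fin_num; exists F.
have [|f [G [nf Gflag Glim]]] := @flag_limit R d F.
  by move=> n; case: (FP n).
exists G => //; apply/eqP; rewrite eq_le; apply/andP; split; last first.
  by apply: ereal_inf_lbound; exists G.
apply/lee_addgt0Pr => e e0.
apply: (@measure_liminf_le _ _ _ P _ (fun n => @sphere_val R d hd @^-1` F (f n))).
- exact: flag_halfspace_measurable.
- by move=> n; apply: flag_halfspace_measurable; case: (FP (f n)).
- by move=> s; exact: Glim.
have := near_infty_natSinv_lt (PosNum e0); apply: filterS => n /= ne.
have [_ /ltW] := FP (f n); move/le_trans; apply; rewrite leeD2l// lee_fin.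
apply: le_trans (ltW ne); rewrite lef_pV2 ?posrE ?ltr0n// ler_nat ltnS.
exact: nf.
Qed.

Lemma flag_inf_le_ahD x : (flag_inf <= ahD P x)%E.
Proof.
apply: le_ereal_inf_tmp => _ [u [/sphereP u1 _] <-].
have [F Fflag Fu] := flag_halfspace_sub_H0 (ltnW hd) u1.
apply: (@le_trans _ _ (mass P F)); first by apply: ereal_inf_lbound; exists F.
by apply: le_mass => //; [exact: flag_halfspace_measurable|exact: H0_measurable].
Qed.

Lemma H0Z a u : 0 < a -> H0 (a *: u) = H0 u.
Proof.
by move=> a0; apply/seteqP; split => y; rewrite /H0/= dotZr pmulr_rge0.
Qed.

Lemma ahD_le_H0 x u : u != 0 -> H0 u x -> (ahD P x <= mass P (H0 u))%E.
Proof.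
move=> /normalize[a a0 a1] ux; apply: ereal_inf_lbound.
by exists (a *: u); rewrite /= H0Z//; split=> //; apply/sphereP.
Qed.

(** The complement of F consists of opposites of nonzero points of F, which
    the tilted halfspaces eventually exclude. Hence the upper limit of their
    masses is at most the mass of F, while x eventually belongs to them, so that
    these masses are at least the depth of x. *)
Lemma ahD_le_flag F x : flag_halfspace F -> F x -> x != 0 ->
  (ahD P x <= mass P F)%E.
Proof.
move=> Fflag Fx x0; have mF := flag_halfspace_measurable Fflag.
have /flag_halfspaceP[v onv FE] := Fflag.
pose u n := tilt n.+1%:R^-1 v d.
apply: (@probability_limsup_ge _ _ _ P _
    (fun n => @sphere_val R d hd @^-1` H0 (u n))) => //.
- by move=> n; exact: H0_measurable.
- move=> s sF; have s0 := unit_neq0 (sphere_val_unit s).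
  have : lex_cone v (- sphere_val s).
    by apply: lex_coneN => //; rewrite -FE.
  move=> /lex_cone_tilt; rewrite oppr_eq0 => /(_ s0); apply: filterS => n.
  by rewrite dotNl oppr_gt0 ltNge => /negP.
- rewrite FE in Fx; have := lex_cone_tilt Fx x0; apply: filterS => n xu.
  apply: ahD_le_H0; last by rewrite /H0/= ltW.
  by apply: contraTneq xu => un0; rewrite -/(u n) un0 dot0r ltxx.
Qed.

Lemma ahD_min_flag F x : flag_halfspace F -> mass P F = flag_inf ->
  (F `&` sphere R d) x -> ahD P x = flag_inf.
Proof.
move=> Fflag Fm [Fx /sphereP/unit_neq0 x0]; apply/eqP.
by rewrite eq_le flag_inf_le_ahD andbT -Fm ahD_le_flag.
Qed.

End mass.

Lemma flag_halfspaceN (R : realType) (d : nat) (F : set 'rV[R]_d) x :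
  flag_halfspace F -> ~ F x -> F (- x).
Proof.
move=> /flag_halfspaceP[v on ->] xF; apply: lex_coneN => //.
by apply: contra_not_neq xF => ->; left.
Qed.

Theorem theorem7 (R : realType) (d : nat) (hd : (2 <= d)%N)
    (P : probability (borel_sphere R hd) R) :
  let flags : set (set 'rV[R]_d) := [set F | flag_halfspace F] in
  let S := sphere R d in
  [/\ exists2 F, flags F & mass P F = ereal_inf [set mass P G | G in flags],
      forall F, flags F ->
        mass P F = ereal_inf [set mass P G | G in flags] ->
        forall x, (F `&` S) x -> is_min [set ahD P y | y in S] (ahD P x)
    & forall mu, S mu ->
        ahD P mu = ereal_sup [set ahD P x | x in S] ->
        ahD P (- mu) = ereal_inf [set ahD P x | x in S]].
Proof.
move=> flags S.
have SN x : S x -> S (- x).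
  by move=> /sphereP x1; apply/sphereP; rewrite dotNl dotC dotNl opprK.
have [F Fflag Fm] := flag_inf_attained P.
have minP G x : flag_halfspace G ->
    mass P G = ereal_inf [set mass P G | G in flags] ->
    (G `&` S) x -> is_min [set ahD P y | y in S] (ahD P x).
  move=> Gflag Gm Gx; split; first by exists x => //; case: Gx.
  by move=> _ [y _ <-]; rewrite (ahD_min_flag Gflag Gm Gx) flag_inf_le_ahD.
have ahD_inf x : (forall y, S y -> (ahD P x <= ahD P y)%E) -> S x ->
    ahD P x = ereal_inf [set ahD P y | y in S].
  move=> xmin xS; apply/eqP; rewrite eq_le; apply/andP; split.
    by apply: le_ereal_inf_tmp => _ [y yS <-]; exact: xmin.
  by apply: ereal_inf_lbound; exists x.
split=> [|G Gflag Gm x|mu muS mu_max]; first by exists F.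
  exact: minP.
apply: ahD_inf => [y yS|]; last exact: SN.
have [Fmu|/(flag_halfspaceN Fflag) FNmu] := pselect (F mu).
  (* The maximal depth is attained in F, so it is the minimal depth as well. *)
  apply: (@le_trans _ _ (ahD P mu)).
    by rewrite mu_max; apply: ereal_sup_ubound; exists (- mu) => //; exact: SN.
  by rewrite (ahD_min_flag Fflag Fm (conj Fmu muS)) flag_inf_le_ahD.
by rewrite (ahD_min_flag Fflag Fm (conj FNmu (SN _ muS))) flag_inf_le_ahD.
Qed.
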